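(* Let $X$ be an $\infty$-projective Banach lattice and let $(u_i)_{i\in\mathbb{N}}$ be a bounded sequence of vectors in $X$. Suppose that there exists a Banach lattice homomorphism $T\colon X\to c_0$ such that $T(u_i)=e_i$ for every $i\in\mathbb{N}$, where $(e_i)_{i\in\mathbb{N}}$ is the canonical basis of $c_0$. Then there is a subsequence $(u_{i_k})_{k\in\mathbb{N}}$ of $(u_i)_{i\in\mathbb{N}}$ that is equivalent to the canonical basis of $\ell_1$.
   Context: All Banach lattices are real. A Banach lattice homomorphism is a bounded linear map preserving the lattice operations $\vee,\wedge$. $c_0$ carries the supremum norm and the coordinatewise order. For a real number $\lambda>1$, a Banach lattice $P$ is $\lambda$-projective if whenever $Y$ is a Banach lattice, $J$ a closed (order) ideal in $Y$ and $Q\colon Y\to Y/J$ the quotient map, then for every Banach lattice homomorphism $R\colon P\to Y/J$ there is a Banach lattice homomorphism $\hat R\colon P\to Y$ such that $R=Q\circ\hat R$ and $\|\hat R\|\le\lambda\|R\|$. $P$ is $\infty$-projective if it is $\lambda$-projective for some $\lambda>1$. A sequence $(v_k)$ in a Banach space is equivalent to the canonical basis of $\ell_1$ if there are constants $c,C>0$ with $c\sum_{k=1}^l|\lambda_k|\le\|\sum_{k=1}^l\lambda_k v_k\|\le C\sum_{k=1}^l|\lambda_k|$ for all $l\in\mathbb{N}$ and $\lambda_1,\dots,\lambda_l\in\mathbb{R}$. *)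

(* Defs.v *)
From HB Require Import structures.
From mathcomp Require Import all_boot all_order all_algebra.
From mathcomp Require Import generic_quotient ring_quotient.
From mathcomp Require Import all_classical all_reals all_analysis.
From mathcomp Require Import ring lra.

Set Implicit Arguments.
Unset Strict Implicit.
Unset Printing Implicit Defensive.

Import Order.TTheory GRing.Theory Num.Theory.
Import numFieldNormedType.Exports.

Local Open Scope classical_set_scope.
Local Open Scope ring_scope.

Declare Scope lattice_vector_scope.
Delimit Scope lattice_vector_scope with LV.
Reserved Notation "x \le y" (at level 70, no associativity).
Reserved Notation "x \vee y" (at level 48, left associativity).
Reserved Notation "x \wedge y" (at level 48, left associativity).

(* The order is a field of the structure rather than an [Order.Lattice]: HB  *)
(* rejects any join of [Zmodule] and [Order.Lattice] declared after          *)
(* [realDomainType].                                                         *)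
HB.mixin Record CompleteNormedModule_isBanachLattice (R : realType) E
    & CompleteNormedModule R E := {
  vle : E -> E -> Prop ;
  vjoin : E -> E -> E ;
  vmeet : E -> E -> E ;
  vle_refl : forall x, vle x x ;
  vle_anti : forall x y, vle x y -> vle y x -> x = y ;
  vle_trans : forall x y z, vle x y -> vle y z -> vle x z ;
  vjoin_le : forall x y z, vle (vjoin x y) z <-> vle x z /\ vle y z ;
  vle_meet : forall x y z, vle z (vmeet x y) <-> vle z x /\ vle z y ;
  vle_add2r : forall z x y, vle x y -> vle (x + z) (y + z) ;
  vscale_ge0 : forall (a : R) x, 0 <= a -> vle 0 x -> vle 0 (a *: x) ;
  vle_norm : forall x y, vle (vjoin x (- x)) (vjoin y (- y)) -> `|x| <= `|y|
}.

#[short(type="banachLatticeType")]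
HB.structure Definition BanachLattice (R : realType) :=
  {E of CompleteNormedModule R E & CompleteNormedModule_isBanachLattice R E}.

Notation "x \le y" := (vle x y) : lattice_vector_scope.
Notation "x \vee y" := (vjoin x y) : lattice_vector_scope.
Notation "x \wedge y" := (vmeet x y) : lattice_vector_scope.
Local Open Scope lattice_vector_scope.

Arguments vle_anti {R s} [x y].
Arguments vle_trans {R s} [x y z].
Arguments vle_add2r {R s} z [x y].
Arguments vscale_ge0 {R s} [a x].

Definition vabs (R : realType) (E : banachLatticeType R) (x : E) : E :=
  x \vee - x.

Record lattice_hom (R : realType) (E F : banachLatticeType R)
    (f : {linear E -> F}) : Prop := LatticeHom {
  hom_bounded : bounded_fun_norm f ;
  hom_join : forall x y, f (x \vee y) = f x \vee f y ;
  hom_meet : forall x y, f (x \wedge y) = f x \wedge f y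
}.

Definition opnorm (R : realType) (E F : normedModType R) (f : E -> F) : R :=
  sup [set `|f x| | x in [set x : E | `|x| <= 1]].

Record closed_ideal (R : realType) (E : banachLatticeType R) := ClosedIdeal {
  ideal_set :> set E ;
  ideal0 : ideal_set 0 ;
  idealD : forall x y, ideal_set x -> ideal_set y -> ideal_set (x + y) ;
  idealZ : forall (a : R) x, ideal_set x -> ideal_set (a *: x) ;
  ideal_solid : forall x y, vabs x \le vabs y -> ideal_set y -> ideal_set x ;
  ideal_closed : closed ideal_set
}.

Section VectorLatticeTheory.
Context (R : realType) (E : banachLatticeType R).
Implicit Types x y z : E.

Lemma vle_joinl x y : x \le x \vee y.
Proof. by have /vjoin_le[] := vle_refl (x \vee y). Qed.

Lemma vle_joinr x y : y \le x \vee y.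
Proof. by have /vjoin_le[] := vle_refl (x \vee y). Qed.

Lemma vmeet_lel x y : x \wedge y \le x.
Proof. by have /vle_meet[] := vle_refl (x \wedge y). Qed.

Lemma vmeet_ler x y : x \wedge y \le y.
Proof. by have /vle_meet[] := vle_refl (x \wedge y). Qed.

Lemma vle_add2l z x y : x \le y -> z + x \le z + y.
Proof. by rewrite ![z + _]addrC; exact: vle_add2r. Qed.

Lemma vle_add x y z t : x \le y -> z \le t -> x + z \le y + t.
Proof. by move=> xy zt; apply: vle_trans (vle_add2r _ xy) (vle_add2l _ zt). Qed.

Lemma vle_subl x y z : x \le y + z <-> x - z \le y.
Proof. by split=> /vle_add2r; [move/(_ (- z)); rewrite addrK|
  move/(_ z); rewrite subrK]. Qed.

Lemma vle_opp x y : x \le y -> - y \le - x.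
Proof.
by move/(vle_add2r (- x - y)); rewrite addrA addrN add0r addrCA addrN addr0.
Qed.

Lemma vabs_ge0 x : 0 \le vabs x.
Proof.
have h : 0 \le vabs x + vabs x.
  by rewrite -(addrN x); apply: vle_add; [exact: vle_joinl|exact: vle_joinr].
have := vscale_ge0 (a := 2^-1) _ h.
rewrite -mulr2n -(scaler_nat 2 (vabs x)) scalerA mulVf ?pnatr_eq0//.
rewrite scale1r; apply.
by rewrite invr_ge0.
Qed.

Lemma vle_abs x : x \le vabs x. Proof. exact: vle_joinl. Qed.

Lemma vleN_abs x : - x \le vabs x. Proof. exact: vle_joinr. Qed.

Lemma vabsN x : vabs (- x) = vabs x.
Proof.
by rewrite /vabs opprK; apply: vle_anti; apply/vjoin_le; split;
  (exact: vle_joinl || exact: vle_joinr).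
Qed.

Lemma vabs_abs x : vabs (vabs x) = vabs x.
Proof.
apply: vle_anti (vle_joinl _ _); apply/vjoin_le; split; first exact: vle_refl.
apply: vle_trans (vabs_ge0 x).
by rewrite -[X in _ \le X]oppr0; apply: vle_opp; exact: vabs_ge0.
Qed.

Lemma vabs_le x y : x \le y -> - x \le y -> vabs x \le y.
Proof. by move=> xy Nxy; apply/vjoin_le. Qed.

Lemma vabs_join2 x y z : vabs (x \vee z - (y \vee z)) \le vabs (x - y).
Proof.
wlog suff H : x y / x \vee z - (y \vee z) \le vabs (x - y).
  apply: vabs_le; rewrite ?opprB; first exact: H.
  by rewrite -[x - y]opprB vabsN; exact: H.
apply/vle_subl; apply/vjoin_le; split.
  rewrite -[x in x \le _](subrK y).
  by apply: vle_add; [exact: vle_abs|exact: vle_joinl].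
rewrite -[z in z \le _]add0r.
by apply: vle_add; [exact: vabs_ge0|exact: vle_joinr].
Qed.

Lemma vabs_meet2 x y z : vabs (x \wedge z - (y \wedge z)) \le vabs (x - y).
Proof.
wlog suff H : x y / x \wedge z - (y \wedge z) \le vabs (x - y).
  apply: vabs_le; rewrite ?opprB; first exact: H.
  by rewrite -[x - y]opprB vabsN; exact: H.
apply/vle_subl; rewrite addrC; apply/vle_subl/vle_meet.
split; apply/vle_subl.
  apply: vle_trans (vmeet_lel _ _) _.
  rewrite -[x in x \le _](subrK y) [_ + y]addrC.
  by apply: vle_add2l; exact: vle_abs.
apply: vle_trans (vmeet_ler _ _) _; rewrite -[z in z \le _]addr0.
by apply: vle_add2l; exact: vabs_ge0.
Qed.

Lemma vjoinC x y : x \vee y = y \vee x.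
Proof.
by apply: vle_anti; apply/vjoin_le; split; (exact: vle_joinl||exact: vle_joinr).
Qed.

Lemma vmeetC x y : x \wedge y = y \wedge x.
Proof.
by apply: vle_anti; apply/vle_meet; split; (exact: vmeet_lel||exact: vmeet_ler).
Qed.

Lemma vmeetA x y z : x \wedge (y \wedge z) = x \wedge y \wedge z.
Proof.
apply: vle_anti; repeat (apply/vle_meet; split).
- exact: vmeet_lel.
- exact: vle_trans (vmeet_ler _ _) (vmeet_lel _ _).
- exact: vle_trans (vmeet_ler _ _) (vmeet_ler _ _).
- exact: vle_trans (vmeet_lel _ _) (vmeet_lel _ _).
- exact: vle_trans (vmeet_lel _ _) (vmeet_ler _ _).
- exact: vmeet_ler.
Qed.

Lemma vmeet_idl x y : x \le y -> x \wedge y = x.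
Proof.
move=> xy; apply: vle_anti (vmeet_lel _ _) _.
by apply/vle_meet; split => //; exact: vle_refl.
Qed.

Lemma vjoin_idr x y : x \le y -> x \vee y = y.
Proof.
move=> xy; apply: vle_anti (vle_joinr _ _).
by apply/vjoin_le; split => //; exact: vle_refl.
Qed.

Lemma vjoinKI x y : x \wedge (x \vee y) = x.
Proof. exact/vmeet_idl/vle_joinl. Qed.

Lemma vmeetKU x y : (x \wedge y) \vee y = y.
Proof. exact/vjoin_idr/vmeet_ler. Qed.

Lemma vjoinA x y z : x \vee (y \vee z) = x \vee y \vee z.
Proof.
apply: vle_anti; repeat (apply/vjoin_le; split).
- exact: vle_trans (vle_joinl _ _) (vle_joinl _ _).
- exact: vle_trans (vle_joinr _ _) (vle_joinl _ _).
- exact: vle_joinr.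
- exact: vle_joinl.
- exact: vle_trans (vle_joinl _ _) (vle_joinr _ _).
- exact: vle_trans (vle_joinr _ _) (vle_joinr _ _).
Qed.

End VectorLatticeTheory.

Section FastCauchy.
Context (R : realType).

Lemma fast_cauchy_bound (V : normedModType R) (x : nat -> V) n k :
  (forall n, `|x n.+1 - x n| <= 2^-1 ^+ n) ->
  `|x (n + k)%N - x n| <= 2 * 2^-1 ^+ n.
Proof.
move=> hx.
suff h : `|x (n + k)%N - x n| <= 2 * 2^-1 ^+ n - 2 * 2^-1 ^+ (n + k).
  by apply: le_trans h _; rewrite gerBl mulr_ge0// exprn_ge0.
elim: k => [|k ih]; first by rewrite addn0 !subrr normr0.
rewrite addnS -(subrK (x (n + k)%N) (x (n + k).+1)) -addrA.
apply: le_trans (ler_normD _ _) _; have := lerD (hx (n + k)%N) ih.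
by move/le_trans; apply; rewrite exprS; lra.
Qed.

Lemma fast_series_cvg (V : completeNormedModType R) (C : R) (z : nat -> V) :
  (forall n, `|z n| <= C * 2^-1 ^+ n) -> cvgn (series z).
Proof.
move=> hz; apply: normed_cvg.
apply: (@series_le_cvg R _ (geometric C 2^-1)) => [n|n|n|].
- exact: normr_ge0.
- exact: le_trans (hz n).
- exact: hz.
- by apply: is_cvg_geometric_series; rewrite ger0_norm// invf_lt1 ?ltr1n.
Qed.

Lemma series_increments (V : zmodType) (x : nat -> V) :
  series (fun n => x n.+1 - x n) = fun n => x n - x 0%N.
Proof. by apply/funext => n; rewrite /series/= telescope_sumr. Qed.

Lemma cvg_increments (V : normedModType R) (x : nat -> V) (l : V) :
  series (fun n => x n.+1 - x n) @ \oo --> l -> x @ \oo --> l + x 0%N.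
Proof.
rewrite series_increments => h.
have -> : x = fun n => x n - x 0%N + x 0%N.
  by apply/funext => n; rewrite subrK.
by rewrite /= subrr add0r; apply: cvgD h _; exact: cvg_cst.
Qed.

Lemma fast_cauchy_cvg (V : completeNormedModType R) (x : nat -> V) :
  (forall n, `|x n.+1 - x n| <= 2^-1 ^+ n) -> cvgn x.
Proof.
move=> hx.
have /cvg_ex[l /cvg_increments/cvgP//] : cvgn (series (fun n => x n.+1 - x n)).
by apply: (@fast_series_cvg _ 1) => n; rewrite mul1r.
Qed.

Lemma complete_of_fast_cauchy (V : normedModType R) :
  (forall x : nat -> V, (forall n, `|x n.+1 - x n| <= 2^-1 ^+ n) -> cvgn x) ->
  forall F : set_system V, ProperFilter F -> cauchy F -> cvg F.
Proof.
move=> hV F FF /cauchyP Fc.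
have half0 n : 0 < 2^-1 ^+ n.+2 :> R by rewrite exprn_gt0.
have /choice[x hx] : forall n, exists x, F (ball x (2^-1 ^+ n.+2 : R)).
  by move=> n; exact: Fc.
have /hV/cvg_ex[l xl] : forall n, `|x n.+1 - x n| <= 2^-1 ^+ n.
  move=> n; have /filter_ex[y] := @filterI _ F FF _ _ (hx n) (hx n.+1).
  rewrite -ball_normE /ball_/= => -[h1 h2].
  rewrite -(subrK y (x n.+1)) -addrA (le_trans (ler_normD _ _))//.
  rewrite (distrC y); have := lerD (ltW h2) (ltW h1); move/le_trans; apply.
  have : 0 <= 2^-1 ^+ n :> R by rewrite exprn_ge0.
  by rewrite !exprS; lra.
apply/cvg_ex; exists l; apply/cvgrPdist_lt => e e0.
have e20 : 0 < e / 2 by rewrite divr_gt0.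
have g0 : (fun n => 2^-1 ^+ n.+2 : R) @ \oo --> (0 : R).
  have := @cvg_geometric R 1 2^-1; rewrite ger0_norm// invf_lt1 ?ltr1n//.
  move=> /(_ isT); rewrite -(cvg_shiftn 2).
  by under eq_fun do rewrite /geometric/= mul1r addn2.
have /filter_ex[n [/= ln nn]] : \forall n \near \oo,
    `|l - x n| < e / 2 /\ `|0 - 2^-1 ^+ n.+2 : R| < e / 2.
  apply: filterI; first by move/cvgrPdist_lt : xl => /(_ _ e20).
  by move/cvgrPdist_lt : g0 => /(_ _ e20).
apply: filterS (hx n) => y; rewrite -ball_normE /ball_/= => xy.
rewrite -(subrK (x n) l) -addrA (le_lt_trans (ler_normD _ _))//.
rewrite [e]splitr ltrD// (lt_trans xy)//.
by move: nn; rewrite sub0r normrN ger0_norm// ltW.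
Qed.

End FastCauchy.

Section QuotientDef.
Context (R : realType) (E : banachLatticeType R) (J : closed_ideal E).

Definition ideal_pred : {pred E} := fun x => `[< ideal_set J x >].

Lemma ideal_predP x : reflect (ideal_set J x) (x \in ideal_pred).
Proof. exact: asboolP. Qed.

Lemma ideal_zmod_closed : zmod_closed ideal_pred.
Proof.
split=> [|x y /ideal_predP xJ /ideal_predP yJ]; apply/ideal_predP.
  exact: ideal0.
by apply: idealD => //; rewrite -scaleN1r; exact: idealZ.
Qed.
HB.instance Definition _ := GRing.isZmodClosed.Build E ideal_pred
  ideal_zmod_closed.

Definition vquotient : Type := Quotient.quot ideal_pred.
HB.instance Definition _ := Choice.on vquotient.
HB.instance Definition _ := GRing.Zmodule.on vquotient.
HB.instance Definition _ := EqQuotient.on vquotient.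

Definition vquotient_map (x : E) : vquotient := (\pi_vquotient x)%qT.
Local Notation Q := vquotient_map.

Lemma vquotient_map_surj (q : vquotient) : exists x, Q x = q.
Proof. by exists (repr q); exact: reprK. Qed.

Lemma vquotient_mapD x y : Q (x + y) = Q x + Q y.
Proof. exact: Quotient.pi_add. Qed.

Lemma vquotient_mapN x : Q (- x) = - Q x.
Proof. exact: Quotient.pi_opp. Qed.

Lemma vquotient_map0 : Q 0 = 0.
Proof. by rewrite -(subrr 0) vquotient_mapD vquotient_mapN subrr. Qed.

Lemma vquotient_mapB x y : Q (x - y) = Q x - Q y.
Proof. by rewrite vquotient_mapD vquotient_mapN. Qed.

Lemma vquotient_map_eq x y : Q x = Q y <-> ideal_set J (x - y).
Proof.
split=> [xy|h].
  by apply/ideal_predP; rewrite Quotient.idealrBE; apply/eqP.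
by apply/eqP; rewrite -[_ == _]Quotient.idealrBE; exact/ideal_predP.
Qed.

Definition vquotient_scale (a : R) (q : vquotient) : vquotient :=
  Q (a *: repr q).

Lemma vquotient_scaleE a x : vquotient_scale a (Q x) = Q (a *: x).
Proof.
apply/vquotient_map_eq; rewrite -scalerBr; apply: idealZ.
by apply/vquotient_map_eq; exact: reprK.
Qed.

Fact vquotient_scalerA a b q :
  vquotient_scale a (vquotient_scale b q) = vquotient_scale (a * b) q.
Proof.
by have [x <-] := vquotient_map_surj q; rewrite !vquotient_scaleE scalerA.
Qed.

Fact vquotient_scale1r : left_id 1 vquotient_scale.
Proof.
move=> q; have [x <-] := vquotient_map_surj q.
by rewrite vquotient_scaleE scale1r.
Qed.

Fact vquotient_scalerDr : right_distributive vquotient_scale +%R.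
Proof.
move=> a p q; have [x <-] := vquotient_map_surj p.
have [y <-] := vquotient_map_surj q.
by rewrite -vquotient_mapD !vquotient_scaleE scalerDr vquotient_mapD.
Qed.

Fact vquotient_scalerDl q :
  {morph vquotient_scale^~ q : a b / a + b >-> a + b}.
Proof.
move=> a b; have [x <-] := vquotient_map_surj q.
by rewrite !vquotient_scaleE scalerDl vquotient_mapD.
Qed.

HB.instance Definition _ := GRing.Zmodule_isLmodule.Build R vquotient
  vquotient_scalerA vquotient_scale1r vquotient_scalerDr vquotient_scalerDl.

Fact vquotient_map_linear : linear Q.
Proof. by move=> a x y; rewrite vquotient_mapD -vquotient_scaleE. Qed.
HB.instance Definition _ :=
  GRing.isLinear.Build R E vquotient _ Q vquotient_map_linear.

Definition vquotient_norm (q : vquotient) : R :=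
  inf [set `|x| | x in [set x | Q x = q]].

Let norms_has_inf q : has_inf [set `|x| | x in [set x | Q x = q]].
Proof.
split; first by have [x <-] := vquotient_map_surj q; exists `|x|, x.
by exists 0 => _ [x _ <-].
Qed.

Lemma vquotient_norm_le x : vquotient_norm (Q x) <= `|x|.
Proof. by apply: ge_inf; [exact: (norms_has_inf _).2|exists x]. Qed.

Lemma vquotient_norm_ge0 q : 0 <= vquotient_norm q.
Proof.
by apply: lb_le_inf; [exact: (norms_has_inf q).1|move=> _ [x _ <-]].
Qed.

Lemma vquotient_norm_lift q (e : R) : 0 < e ->
  exists2 x, Q x = q & `|x| < vquotient_norm q + e.
Proof.
by move=> /inf_adherent/(_ (norms_has_inf q))[_ [x xq <-] xe]; exists x.
Qed.

Fact vquotient_normD p q :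
  vquotient_norm (p + q) <= vquotient_norm p + vquotient_norm q.
Proof.
apply/ler_addgt0Pr => e e0; have e20 : 0 < e / 2 by rewrite divr_gt0.
have [x <- hx] := vquotient_norm_lift p e20.
have [y <- hy] := vquotient_norm_lift q e20.
rewrite -vquotient_mapD (le_trans (vquotient_norm_le _))//.
rewrite (le_trans (ler_normD _ _))//; lra.
Qed.

Let vquotient_normZ_le a q : vquotient_norm (a *: q) <= `|a| * vquotient_norm q.
Proof.
have [->|a0] := eqVneq a 0.
  rewrite scale0r normr0 mul0r -vquotient_map0.
  rewrite (le_trans (vquotient_norm_le _))//.
  by rewrite normr0.
apply/ler_addgt0Pr => e e0.
have ea0 : 0 < e / `|a| by rewrite divr_gt0// normr_gt0.
have [x <- hx] := vquotient_norm_lift q ea0.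
rewrite -linearZ (le_trans (vquotient_norm_le _))// normrZ.
have := ltW hx; rewrite -(ler_pM2l (x := `|a|)) ?normr_gt0//.
by rewrite mulrDr mulrCA mulfV ?mulr1 ?normr_eq0.
Qed.

Fact vquotient_normZ a q : vquotient_norm (a *: q) = `|a| * vquotient_norm q.
Proof.
have [->|a0] := eqVneq a 0.
  apply/eqP; rewrite eq_le vquotient_normZ_le normr0 mul0r.
  exact: vquotient_norm_ge0.
apply/eqP; rewrite eq_le vquotient_normZ_le /=.
have := vquotient_normZ_le a^-1 (a *: q).
rewrite scalerA mulVf// scale1r normfV ler_pdivlMl ?normr_gt0//.
Qed.

Fact vquotient_norm0_eq0 q : vquotient_norm q = 0 -> q = 0.
Proof.
have [x <-] := vquotient_map_surj q => h.
rewrite -vquotient_map0; apply/vquotient_map_eq; rewrite subr0.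
apply: (@ideal_closed _ _ J) => B /nbhs_ballP[e /= e0 eB].
have [y yx] := vquotient_norm_lift (Q x) e0; rewrite h add0r => ye.
exists (x - y); split; first exact/vquotient_map_eq.
by apply: eB; rewrite -ball_normE /ball_/= opprB addrC subrK.
Qed.

HB.instance Definition _ := @Lmodule_isNormed.Build R vquotient
  vquotient_norm vquotient_normD vquotient_normZ vquotient_norm0_eq0.

Lemma vquotient_map_continuous : continuous (Q : E -> vquotient).
Proof.
move=> x; apply/cvgrPdist_lt => e e0; near=> y.
rewrite -vquotient_mapB (le_lt_trans (vquotient_norm_le _))//.
Unshelve. all: by end_near. Qed.

Fact vquotient_complete (F : set_system vquotient) :
  ProperFilter F -> cauchy F -> cvg F.
Proof.
apply: complete_of_fast_cauchy => x hx.
have h n : exists z, Q z = x n.+1 - x n /\ `|z| <= 2 * 2^-1 ^+ n.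
  have e0 : 0 < 2^-1 ^+ n :> R by rewrite exprn_gt0.
  have [z zx hz] := vquotient_norm_lift (x n.+1 - x n) e0.
  exists z; split=> //; rewrite (le_trans (ltW hz))//.
  by have := hx n; rewrite -[X in X <= _]/(vquotient_norm _); lra.
have [z hz] := choice h.
have /cvg_ex[l zl] : cvgn (series z).
  by apply: (@fast_series_cvg _ _ 2) => n; have [] := hz n.
apply: (@cvgP _ _ (Q l + x 0%N)); apply: cvg_increments.
have -> : series (fun n => x n.+1 - x n) = Q \o series z.
  apply/funext => n; rewrite /series/= raddf_sum.
  by apply: eq_bigr => i _; have [] := hz i.
by apply: (cvg_comp _ _ zl); exact: vquotient_map_continuous.
Qed.

HB.instance Definition _ :=
  Uniform_isComplete.Build vquotient vquotient_complete.

Definition vquotient_join (p q : vquotient) : vquotient :=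
  Q (repr p \vee repr q).
Definition vquotient_meet (p q : vquotient) : vquotient :=
  Q (repr p \wedge repr q).
Definition vquotient_le (p q : vquotient) : Prop :=
  exists x y, [/\ Q x = p, Q y = q & x \le y].

Let repr_sub x : ideal_set J (repr (Q x) - x).
Proof. by apply/vquotient_map_eq; exact: reprK. Qed.

Lemma vquotient_joinE x y : vquotient_join (Q x) (Q y) = Q (x \vee y).
Proof.
transitivity (Q (x \vee repr (Q y))); apply/vquotient_map_eq.
  exact: ideal_solid (vabs_join2 _ _ _) (repr_sub x).
rewrite ![x \vee _]vjoinC.
exact: ideal_solid (vabs_join2 _ _ _) (repr_sub y).
Qed.

Lemma vquotient_meetE x y : vquotient_meet (Q x) (Q y) = Q (x \wedge y).
Proof.
transitivity (Q (x \wedge repr (Q y))); apply/vquotient_map_eq.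
  exact: ideal_solid (vabs_meet2 _ _ _) (repr_sub x).
rewrite ![x \wedge _]vmeetC.
exact: ideal_solid (vabs_meet2 _ _ _) (repr_sub y).
Qed.

Lemma vquotient_leP x y : vquotient_le (Q x) (Q y) <-> Q (x \wedge y) = Q x.
Proof.
split=> [[x' [y' [xx yy xy]]]|h].
  by rewrite -vquotient_meetE -xx -yy vquotient_meetE (vmeet_idl xy).
by exists (x \wedge y), y; split=> //; exact: vmeet_ler.
Qed.

Lemma vquotient_leP' x y : vquotient_le (Q x) (Q y) <-> Q (x \vee y) = Q y.
Proof.
split=> [[x' [y' [xx yy xy]]]|h].
  by rewrite -vquotient_joinE -xx -yy vquotient_joinE (vjoin_idr xy).
by exists x, (x \vee y); split=> //; exact: vle_joinl.
Qed.

Fact vquotient_le_refl p : vquotient_le p p.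
Proof.
have [x <-] := vquotient_map_surj p.
by exists x, x; split=> //; exact: vle_refl.
Qed.

Fact vquotient_le_anti p q : vquotient_le p q -> vquotient_le q p -> p = q.
Proof.
have [x <-] := vquotient_map_surj p; have [y <-] := vquotient_map_surj q.
by move=> /vquotient_leP xy /vquotient_leP yx; rewrite -xy vmeetC.
Qed.

Fact vquotient_le_trans p q r :
  vquotient_le p q -> vquotient_le q r -> vquotient_le p r.
Proof.
have [x <-] := vquotient_map_surj p; have [y <-] := vquotient_map_surj q.
have [z <-] := vquotient_map_surj r.
move=> /vquotient_leP xy /vquotient_leP yz; apply/vquotient_leP.
rewrite -[LHS]vquotient_meetE -xy vquotient_meetE -vmeetA.
by rewrite -[LHS]vquotient_meetE yz vquotient_meetE.
Qed.

Fact vquotient_join_le p q r :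
  vquotient_le (vquotient_join p q) r <-> vquotient_le p r /\ vquotient_le q r.
Proof.
have [x <-] := vquotient_map_surj p; have [y <-] := vquotient_map_surj q.
have [z <-] := vquotient_map_surj r; rewrite vquotient_joinE.
split=> [h|[/vquotient_leP' xz /vquotient_leP' yz]].
  split; apply: vquotient_le_trans h.
    by exists x, (x \vee y); split=> //; exact: vle_joinl.
  by exists y, (x \vee y); split=> //; exact: vle_joinr.
apply/vquotient_leP'.
by rewrite -vjoinA -[LHS]vquotient_joinE yz vquotient_joinE.
Qed.

Fact vquotient_le_meet p q r :
  vquotient_le r (vquotient_meet p q) <-> vquotient_le r p /\ vquotient_le r q.
Proof.
have [x <-] := vquotient_map_surj p; have [y <-] := vquotient_map_surj q.
have [z <-] := vquotient_map_surj r; rewrite vquotient_meetE.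
split=> [h|[/vquotient_leP zx /vquotient_leP zy]].
  split; apply: vquotient_le_trans h _.
    by exists (x \wedge y), x; split=> //; exact: vmeet_lel.
  by exists (x \wedge y), y; split=> //; exact: vmeet_ler.
apply/vquotient_leP.
by rewrite vmeetA -[LHS]vquotient_meetE zx vquotient_meetE.
Qed.

Fact vquotient_le_add2r r p q :
  vquotient_le p q -> vquotient_le (p + r) (q + r).
Proof.
have [z <-] := vquotient_map_surj r => -[x [y [<- <- xy]]].
exists (x + z), (y + z); rewrite !vquotient_mapD.
by split=> //; exact: vle_add2r.
Qed.

Fact vquotient_scale_ge0 (a : R) p :
  0 <= a -> vquotient_le 0 p -> vquotient_le 0 (a *: p).
Proof.
move=> a0 [x [y [x0 <- xy]]]; exists (a *: x), (a *: y).
rewrite !linearZ /= x0 scaler0; split=> //.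
have yx0 : 0 \le y - x by rewrite -(subrr x); exact: vle_add2r.
have := vle_add2r (a *: x) (vscale_ge0 a0 yx0).
by rewrite scalerBr add0r subrK.
Qed.

Fact vquotient_le_norm p q :
  vquotient_le (vquotient_join p (- p)) (vquotient_join q (- q)) ->
  `|p| <= `|q|.
Proof.
have [x <-] := vquotient_map_surj p; have [y0 <-] := vquotient_map_surj q => h.
apply: lb_le_inf; first exact: (norms_has_inf _).1.
move=> _ [y yq <-]; move: h; have <- : Q y = Q y0 := yq.
rewrite -!vquotient_mapN !vquotient_joinE => h.
pose x' := x \wedge vabs y \vee - vabs y.
have <- : Q x' = Q x.
  have /vquotient_join_le[] : vquotient_le (vquotient_join (Q x) (Q (- x)))
      (Q (vabs y)) by rewrite vquotient_joinE.
  move=> /vquotient_leP xy /vquotient_leP' Nxy.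
  have {}Nxy : Q (- vabs y \vee x) = Q x.
    apply/vquotient_leP'; have /vquotient_leP' := Nxy => -[u [v [ux vy uv]]].
    exists (- v), (- u); rewrite !vquotient_mapN ux vy vquotient_mapN opprK.
    by split=> //; exact: vle_opp.
  by rewrite /x' -vquotient_joinE xy vquotient_joinE vjoinC.
rewrite (le_trans (vquotient_norm_le _))//; apply: vle_norm.
rewrite -!/(vabs _) -/(vabs y); apply: vabs_le.
  apply/vjoin_le; split; first exact: vmeet_ler.
  apply: vle_trans (vabs_ge0 y); rewrite -[X in _ \le X]oppr0.
  by apply: vle_opp; exact: vabs_ge0.
rewrite -[X in _ \le X]opprK; apply: vle_opp; exact: vle_joinr.
Qed.

HB.instance Definition _ :=
  CompleteNormedModule_isBanachLattice.Build R vquotient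
  vquotient_le_refl vquotient_le_anti vquotient_le_trans
  vquotient_join_le vquotient_le_meet vquotient_le_add2r vquotient_scale_ge0
  vquotient_le_norm.

Lemma vquotient_map_hom : lattice_hom (Q : {linear E -> vquotient}).
Proof.
split=> [r|x y|x y].
- by exists r => x; exact: le_trans (vquotient_norm_le x).
- exact/esym/vquotient_joinE.
- exact/esym/vquotient_meetE.
Qed.


End QuotientDef.

Section C0.
Context (R : realType).

Definition c0_pred : {pred nat -> R} := fun u => `[< u @ \oo --> (0 : R) >].

Record c0 : Type := C0 { c0_val :> nat -> R ; c0_valP : c0_val \in c0_pred }.

HB.instance Definition _ := [isSub for c0_val].
HB.instance Definition _ := [Choice of c0 by <:].

Lemma c0_cvg (u : c0) : u @ \oo --> (0 : R).
Proof. by have /asboolP := c0_valP u. Qed.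

Lemma c0_submod_closed : submod_closed c0_pred.
Proof.
split=> [|a u v /asboolP u0 /asboolP v0]; apply/asboolP; first exact: cvg_cst.
rewrite -[X in _ --> X](addr0 (0 : R)) -[X in _ --> X + _](mulr0 a).
by apply: cvgD v0; apply: cvgMr.
Qed.
HB.instance Definition _ :=
  GRing.isSubmodClosed.Build R (nat -> R) c0_pred c0_submod_closed.
HB.instance Definition _ := [SubChoice_isSubLmodule of c0 by <:].

Implicit Types u v w : c0.

Lemma c0_eq (u v : c0) : (forall n, u n = v n) -> u = v.
Proof. by move=> uv; apply/val_inj/funext. Qed.

Definition c0_norm (u : c0) : R := sup (range (fun n => `|u n|)).

Let norms_has_sup (u : c0) : has_sup (range (fun n => `|u n|)).
Proof.
split; first by exists `|u 0%N|, 0%N.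
have /cvg_seq_bounded[M [_ hM]] := cvgP _ (c0_cvg u).
by exists (M + 1) => _ [n _ <-]; apply: (hM (M + 1)) => //; rewrite ltrDl.
Qed.

Lemma c0_norm_ub u n : `|u n| <= c0_norm u.
Proof. by apply: ub_le_sup; [exact: (norms_has_sup u).2|exists n]. Qed.

Lemma c0_norm_le u (M : R) : (forall n, `|u n| <= M) -> c0_norm u <= M.
Proof.
by move=> h; apply: sup_le_ub; [exact: (norms_has_sup u).1|move=> _ [n _ <-]].
Qed.

Fact c0_normD u v : c0_norm (u + v) <= c0_norm u + c0_norm v.
Proof.
apply: c0_norm_le => n; apply: le_trans (ler_normD (u n) (v n)) _.
by apply: lerD; exact: c0_norm_ub.
Qed.

Let c0_normZ_le a u : c0_norm (a *: u) <= `|a| * c0_norm u.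
Proof.
apply: c0_norm_le => n; rewrite -[(a *: u) n]/(a * u n) normrM.
by rewrite ler_wpM2l// c0_norm_ub.
Qed.

Fact c0_normZ a u : c0_norm (a *: u) = `|a| * c0_norm u.
Proof.
apply/eqP; rewrite eq_le c0_normZ_le /=.
have [->|a0] := eqVneq a 0.
  by rewrite normr0 mul0r (le_trans _ (c0_norm_ub _ 0%N)).
have := c0_normZ_le a^-1 (a *: u).
by rewrite scalerA mulVf// scale1r normfV ler_pdivlMl ?normr_gt0.
Qed.

Fact c0_norm0_eq0 u : c0_norm u = 0 -> u = 0.
Proof.
move=> u0; apply: c0_eq => n; apply/eqP; rewrite -normr_le0 -u0.
exact: c0_norm_ub.
Qed.

HB.instance Definition _ := @Lmodule_isNormed.Build R c0
  c0_norm c0_normD c0_normZ c0_norm0_eq0.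

Fact c0_complete (F : set_system c0) : ProperFilter F -> cauchy F -> cvg F.
Proof.
apply: complete_of_fast_cauchy => x hx.
have hxk k n : `|x n.+1 k - x n k| <= 2^-1 ^+ n.
  exact: le_trans (c0_norm_ub (x n.+1 - x n) k) (hx n).
have /choice[l xl] : forall k, exists l : R, (fun n => x n k) @ \oo --> l.
  by move=> k; apply/cvg_ex; exact: (fast_cauchy_cvg (hxk k)).
have lx k n : `|l k - x n k| <= 2 * 2^-1 ^+ n.
  have cv : (fun m => `|x (n + m)%N k - x n k|) @ \oo --> `|l k - x n k|.
    apply: cvg_norm; apply: cvgB; last exact: cvg_cst.
    by under eq_fun do rewrite addnC; have := xl k; rewrite -(cvg_shiftn n).
  apply: (closed_cvg (fun z : R => z <= 2 * 2^-1 ^+ n) _ _ _ cv).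
    exact: closed_le.
  by apply: nearW => m /=; exact: (fast_cauchy_bound _ _ (hxk k)).
have e0 : (fun n => 2 * 2^-1 ^+ n : R) @ \oo --> (0 : R).
  by apply: cvg_geometric; rewrite ger0_norm// invf_lt1 ?ltr1n.
have small e : 0 < e -> exists n, forall k, `|l k - x n k| < e.
  move=> ?; have /cvgrPdist_lt/(_ _ ltac:(eassumption))/filter_ex[n] := e0.
  rewrite sub0r normrN ger0_norm ?mulr_ge0 ?exprn_ge0// => ne.
  by exists n => k; exact: le_lt_trans (lx k n) ne.
have lc0 : l \in c0_pred.
  apply/asboolP/cvgrPdist_lt => e e_gt0; have e20 : 0 < e / 2 by lra.
  have [n hn] := small _ e20; near=> k.
  rewrite distrC -(subrK (x n k) (l k)) -addrA (le_lt_trans (ler_normD _ _))//.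
  rewrite [e]splitr ltrD// distrC; near: k.
  by move: (c0_cvg (x n)) => /cvgrPdist_lt; apply.
apply: (@cvgP _ _ (C0 lc0)); apply/cvgrPdist_le => e e_gt0.
have := e0 => /cvgrPdist_lt/(_ _ e_gt0); apply: filterS => n.
rewrite sub0r normrN ger0_norm ?mulr_ge0 ?exprn_ge0// => ne.
by apply: c0_norm_le => k; exact: le_trans (lx k n) (ltW ne).
Unshelve. all: by end_near. Qed.

HB.instance Definition _ := Uniform_isComplete.Build c0 c0_complete.

Definition c0_le (u v : c0) : Prop := forall n, u n <= v n.

Lemma c0_pick u v (w : nat -> R) :
  (forall n, w n = u n \/ w n = v n) -> w \in c0_pred.
Proof.
move=> h; apply/asboolP/cvgrPdist_lt => e e0; near=> n.
have [->|->] := h n; near: n.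
  by move: (c0_cvg u) => /cvgrPdist_lt; apply.
by move: (c0_cvg v) => /cvgrPdist_lt; apply.
Unshelve. all: by end_near. Qed.

Lemma c0_join_proof u v : (fun n => Num.max (u n) (v n)) \in c0_pred.
Proof.
by apply: (@c0_pick u v) => n; rewrite maxEle; case: ifP; [right|left].
Qed.
Definition c0_join u v : c0 := C0 (c0_join_proof u v).

Lemma c0_meet_proof u v : (fun n => Num.min (u n) (v n)) \in c0_pred.
Proof.
by apply: (@c0_pick u v) => n; rewrite minEle; case: ifP; [left|right].
Qed.
Definition c0_meet u v : c0 := C0 (c0_meet_proof u v).

Fact c0_le_refl u : c0_le u u. Proof. by move=> n. Qed.

Fact c0_le_anti u v : c0_le u v -> c0_le v u -> u = v.
Proof. by move=> uv vu; apply: c0_eq => n; apply: le_anti; rewrite uv vu. Qed.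

Fact c0_le_trans u v w : c0_le u v -> c0_le v w -> c0_le u w.
Proof. by move=> uv vw n; exact: le_trans (uv n) (vw n). Qed.

Fact c0_join_le u v w : c0_le (c0_join u v) w <-> c0_le u w /\ c0_le v w.
Proof.
split=> [h|[uw vw] n]; last by rewrite ge_max uw vw.
by split=> n; have := h n; rewrite ge_max => /andP[].
Qed.

Fact c0_le_meet u v w : c0_le w (c0_meet u v) <-> c0_le w u /\ c0_le w v.
Proof.
split=> [h|[wu wv] n]; last by rewrite le_min wu wv.
by split=> n; have := h n; rewrite le_min => /andP[].
Qed.

Fact c0_le_add2r w u v : c0_le u v -> c0_le (u + w) (v + w).
Proof. by move=> uv n; exact: lerD (uv n) (lexx _). Qed.

Fact c0_scale_ge0 (a : R) u : 0 <= a -> c0_le 0 u -> c0_le 0 (a *: u).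
Proof. by move=> a0 u0 n; exact: mulr_ge0 a0 (u0 n). Qed.

Fact c0_le_norm u v :
  c0_le (c0_join u (- u)) (c0_join v (- v)) -> `|u| <= `|v|.
Proof.
move=> h; apply: c0_norm_le => n; apply: le_trans (c0_norm_ub v n).
have maxN (a : R) : Num.max a (- a) = `|a|.
  by rewrite maxC real_maxNr// num_real.
by rewrite -!maxN; exact: h.
Qed.

HB.instance Definition _ := CompleteNormedModule_isBanachLattice.Build R c0
  c0_le_refl c0_le_anti c0_le_trans c0_join_le c0_le_meet c0_le_add2r
  c0_scale_ge0 c0_le_norm.

Lemma c0_basis_proof (i : nat) : (fun n => (n == i)%:R) \in c0_pred.
Proof.
apply/asboolP; apply: cvg_near_cst; near=> n.
have /ltn_eqF : (i < n)%N by near: n; exact: nbhs_infty_gt.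
by rewrite eq_sym => ->.
Unshelve. all: by end_near. Qed.
Definition c0_basis (i : nat) : c0 := C0 (c0_basis_proof i).

End C0.

Section Projectivity.
Context (R : realType).

Definition lambda_projective (lambda : R) (P : banachLatticeType R) : Prop :=
  forall (Y : banachLatticeType R) (J : closed_ideal Y)
    (S : {linear P -> vquotient J}), lattice_hom S ->
  exists Shat : {linear P -> Y},
    [/\ lattice_hom Shat,
        forall x, S x = vquotient_map J (Shat x)
      & opnorm Shat <= lambda * opnorm S].

Definition infty_projective (P : banachLatticeType R) : Prop :=
  exists2 lambda : R, 1 < lambda & lambda_projective lambda P.

Definition equivalent_l1_basis (V : normedModType R) (v : nat -> V) : Prop :=
  exists c C : R, [/\ 0 < c, 0 < C &
    forall (l : nat) (a : nat -> R),
      c * (\sum_(k < l) `|a k|) <= `|\sum_(k < l) a k *: v k|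
                                <= C * (\sum_(k < l) `|a k|)].

End Projectivity.

(* Main.v *)
(* Let [Y] be the space of functions on the pairs [(i, m)], seen as           *)
(* intervals [i, m] of [nat], with the norm sup sum_k |f (i_k, m_k)| over     *)
(* finite families of successive intervals, and let [J] be the closed ideal   *)
(* of those [f] with [f (i, m) --> 0] as [m --> oo] for each [i].  Every [a]  *)
(* in [c_0] is the row limit of some [f] in [Y] with [|f| <= 2 |a|], which    *)
(* gives a lattice homomorphism [c_0 -> Y/J].  Lifting [X -> c_0 -> Y/J] to   *)
(* [Y] sends [u_i] to some [f_i] with [f_i (i, m) --> 1] as [m --> oo], so    *)
(* there is an infinite chain [x_k = (i_k, m_k)] with [|f_(i_k) (x_k)|]       *)
(* bounded below.  The rows [k |-> f_(i_j) (x_k)] are bounded in [l_1], so    *)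
(* Rosenthal's disjointification lemma makes the off-diagonal terms small     *)
(* along a subsequence, and summing along the chain then gives the lower      *)
(* [l_1]-estimate.                                                            *)
From HB Require Import structures.
Require Import Defs.
From mathcomp Require Import all_boot all_order all_algebra.
From mathcomp Require Import all_classical all_reals all_analysis.
From mathcomp Require Import lra.

Set Implicit Arguments.
Unset Strict Implicit.
Unset Printing Implicit Defensive.

Import Order.TTheory GRing.Theory Num.Theory.
Import numFieldNormedType.Exports.

Local Open Scope classical_set_scope.
Local Open Scope ring_scope.

(** Projectivity is tested on one quotient [Y/J] in which the unit vectors of [c_0] can only be
    lifted to vectors of [Y] that behave like the basis of l_1. A vector of [Y] representing [e_i]
    tends to 1 along row [i], so it has a value of modulus at least 1/2 at some interval [[i, m]].
    Successive such intervals form a chain, and along a chain the norm of [Y] dominates an l_1-sum.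
    Thus every bounded sequence of representatives has a subsequence with a lower l_1-estimate
    ([chain_space_l1], resting on [rosenthal_increasing]).

    That [c_0] maps into [Y/J] at all is the content of [row_limit_lift] and [c0_quotient_hom]:
    delaying the value [a i] to late columns keeps chain sums bounded without changing the row
    limits. The lift [X -> Y] is bounded, so the lower estimate passes back to the [u_i]; the upper
    one is the triangle inequality. *)

Lemma injective_nat_increasing (phi : nat -> nat) : injective phi ->
  exists theta : nat -> nat, {homo phi \o theta : m n / (m < n)%N}.
Proof.
move=> phi_inj.
have /choice[g hg] : forall n, exists k, (phi n < phi k)%N.
  move=> n; apply: contrapT => /forallNP H.
  (* Pigeonhole: [phi n + 2] distinct values cannot all be at most [phi n]. *)
  have u : uniq (map phi (iota 0 (phi n).+2)).
    by rewrite map_inj_uniq// iota_uniq.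
  have /(uniq_leq_size u) : {subset map phi (iota 0 (phi n).+2)
      <= iota 0 (phi n).+1}.
    move=> _ /mapP[k _ ->]; rewrite mem_iota add0n /= ltnS leqNgt.
    exact/negP.
  by rewrite size_map !size_iota ltnn.
exists (fun k => iter k g 0%N); apply: homo_ltn; first exact: ltn_trans.
by move=> k; exact: hg.
Qed.

(** * Rosenthal's disjointification lemma for matrices *)

Section Rosenthal.
Context (R : realType).
Implicit Types A : nat -> nat -> R.

(** Duplicate-free finite lists replace the infinite row sum off the diagonal, so that reindexing by
    an injection is a [map]. *)
Definition off_diagonal_le (C : R) A : Prop :=
  forall j s, uniq s -> j \notin s -> \sum_(k <- s) A j k <= C.

Lemma off_diagonal_le_comp C A (phi : nat -> nat) : injective phi ->
  off_diagonal_le C A -> off_diagonal_le C (fun j k => A (phi j) (phi k)).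
Proof.
move=> phi_inj hA j s us js.
have := hA (phi j) (map phi s); rewrite big_map; apply.
- by rewrite map_inj_uniq.
- by rewrite mem_map.
Qed.

(* Split [nat] into infinitely many infinite blocks.  If no block works,     *)
(* pick in each block a row whose mass inside the block exceeds [eps]; among *)
(* the picked indices the row sums have dropped by [eps].                    *)
Lemma rosenthal_injective (eps : R) p A : 0 <= eps ->
  off_diagonal_le (p%:R * eps) A ->
  exists2 phi : nat -> nat, injective phi &
    off_diagonal_le eps (fun j k => A (phi j) (phi k)).
Proof.
move=> eps0; elim: p A => [|p IH] A hA.
  exists id; first exact: inj_id.
  by move=> j s us js; apply: le_trans (hA j s us js) _; rewrite mul0r.
pose psi (j k : nat) : nat := pickle (j, k).
have psi_inj j k j' k' : psi j k = psi j' k' -> (j, k) = (j', k').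
  exact: (pcan_inj pickleK).
have psij_inj j : injective (psi j) by move=> k k' /psi_inj[].
have [[j hj]|H] :=
  pselect (exists j, off_diagonal_le eps (fun k l => A (psi j k) (psi j l))).
  by exists (psi j).
have {H}/choice[r hr] : forall j, exists i, exists s, [/\ uniq s, i \notin s &
    eps < \sum_(k <- s) A (psi j i) (psi j k)].
  move=> j; apply: contrapT => Hj; apply: H; exists j => i s us si.
  by rewrite leNgt; apply/negP => lt; apply: Hj; exists i, s.
pose rho j := psi j (r j).
have rho_inj : injective rho by move=> j k /psi_inj[].
have [|phi phi_inj hphi] := IH (fun j k => A (rho j) (rho k)); last first.
  by exists (rho \o phi) => //; exact: inj_comp.
move=> j s us js; have [t [ut jt lt]] := hr j.
(* As [j] is not in [s], the picked indices [rho s] avoid block [j], which contains the witnesses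
   [t]. Row [rho j] therefore bears both sums, and the second exceeds [eps]. *)
have := hA (rho j) (map rho s ++ map (psi j) t).
rewrite big_cat !big_map /= -natr1 mulrDl mul1r => hA'.
suff: \sum_(k <- s) A (rho j) (rho k) +
      \sum_(k <- t) A (rho j) (psi j k) <= p%:R * eps + eps.
  by rewrite /rho; lra.
apply: hA'.
  rewrite cat_uniq !map_inj_uniq// us ut andbT /=.
  apply/hasPn => _ /mapP[k _ ->]; apply/mapP => -[i si /psi_inj[ij _]].
  by rewrite ij si in js.
by rewrite mem_cat negb_or mem_map// js /rho mem_map.
Qed.

Lemma rosenthal_increasing (C eps : R) A : 0 < eps -> off_diagonal_le C A ->
  exists2 phi : nat -> nat, {homo phi : m n / (m < n)%N} &
    off_diagonal_le eps (fun j k => A (phi j) (phi k)).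
Proof.
move=> eps0 hA.
have [|phi phi_inj hphi] :=
  @rosenthal_injective eps (Num.truncn (C / eps)).+1 A (ltW eps0).
  move=> j s us js; apply: le_trans (hA j s us js) _.
  by rewrite -ler_pdivrMr// ltW// truncnS_gt.
have [theta htheta] := injective_nat_increasing phi_inj.
exists (phi \o theta) => //; apply: (off_diagonal_le_comp _ hphi).
by move=> j k jk; case: (ltngtP j k) => // /htheta /=; rewrite jk ltnn.
Qed.

End Rosenthal.

(* A pair [(i, m)] stands for the interval [i, m]; when [m < i] it is the    *)
(* point [i], hence the [maxn].                                              *)
Definition interval_chain (x : nat -> nat * nat) : Prop :=
  forall k l, (k < l)%N -> (maxn (x k).1 (x k).2 < (x l).1)%N.

Lemma interval_chain_comp x (phi : nat -> nat) :
  {homo phi : m n / (m < n)%N} -> interval_chain x -> interval_chain (x \o phi).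
Proof. by move=> hphi hx k l /hphi/hx. Qed.

Lemma interval_chain_step x :
  (forall k, maxn (x k).1 (x k).2 < (x k.+1).1)%N -> interval_chain x.
Proof.
move=> hx k l; elim: l => // l IH; rewrite ltnS leq_eqVlt => /predU1P[->//|kl].
apply: leq_trans (IH kl) (ltnW (leq_ltn_trans _ (hx l))); exact: leq_maxl.
Qed.

(** Continuing [p] by far away one-point intervals makes it the start of a chain; hence the chain
    norm dominates point evaluations. *)
Lemma interval_chain_at (p : nat * nat) :
  exists2 x, interval_chain x & x 0%N = p.
Proof.
pose x k := if k is j.+1 then ((maxn p.1 p.2 + k)%N, 0%N) else p.
exists x => //; apply: interval_chain_step => -[|k] /=; first by rewrite addn1.
by rewrite maxn0 ltn_add2l.
Qed.

(** * The Banach lattice [Y] of functions with bounded chain sums, and its ideal [J] *)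

Section ChainSpace.
Context (R : realType).

(** Cutting infinite chains at [n] loses nothing, since any finite chain extends to an infinite
    one. *)
Definition chain_sums (f : nat * nat -> R) : set R :=
  [set s | exists x n, interval_chain x /\ s = \sum_(k < n) `|f (x k)|].

Definition chain_pred : {pred nat * nat -> R} :=
  fun f => `[< has_ubound (chain_sums f) >].

Record chain_space : Type := ChainSpace {
  chain_val :> nat * nat -> R ;
  chain_valP : chain_val \in chain_pred
}.

HB.instance Definition _ := [isSub for chain_val].
HB.instance Definition _ := [Choice of chain_space by <:].

Lemma chain_predP (f : nat * nat -> R) : f \in chain_pred <->
  exists M, forall x n, interval_chain x -> \sum_(k < n) `|f (x k)| <= M.
Proof.
split=> [/asboolP[M hM]|[M hM]].
  by exists M => x n hx; apply: hM; exists x, n.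
by apply/asboolP; exists M => _ [x [n [hx ->]]]; exact: hM.
Qed.

Lemma chain_submod_closed : submod_closed chain_pred.
Proof.
split=> [|a f g /chain_predP[M hM] /chain_predP[N hN]]; apply/chain_predP.
  by exists 0 => x n _; rewrite big1// => k _; rewrite normr0.
exists (`|a| * M + N) => x n hx.
have := lerD (ler_wpM2l (normr_ge0 a) (hM x n hx)) (hN x n hx).
apply: le_trans; rewrite mulr_sumr -big_split /=; apply: ler_sum => k _.
by rewrite -normrM; exact: ler_normD.
Qed.
HB.instance Definition _ :=
  GRing.isSubmodClosed.Build R (nat * nat -> R) chain_pred chain_submod_closed.
HB.instance Definition _ := [SubChoice_isSubLmodule of chain_space by <:].

Implicit Types f g h : chain_space.

Lemma chain_eq f g : (forall p, f p = g p) -> f = g.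
Proof. by move=> fg; apply/val_inj/funext. Qed.

Definition chain_norm f : R := sup (chain_sums f).

Lemma chain_norm_ub f x n :
  interval_chain x -> \sum_(k < n) `|f (x k)| <= chain_norm f.
Proof.
move=> hx; apply: ub_le_sup; first by have /asboolP := chain_valP f.
by exists x, n.
Qed.

Lemma chain_norm_le f (M : R) :
  (forall x n, interval_chain x -> \sum_(k < n) `|f (x k)| <= M) ->
  chain_norm f <= M.
Proof.
move=> hM; apply: sup_le_ub.
  have [x hx _] := interval_chain_at (0%N, 0%N).
  by exists (\sum_(k < 0) `|f (x k)|), x, 0%N.
by move=> _ [x [n [hx ->]]]; exact: hM.
Qed.

Lemma chain_norm_ge f p : `|f p| <= chain_norm f.
Proof.
have [x hx <-] := interval_chain_at p.
by have := chain_norm_ub f 1 hx; rewrite big_ord1.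
Qed.

Fact chain_normD f g : chain_norm (f + g) <= chain_norm f + chain_norm g.
Proof.
apply: chain_norm_le => x n hx.
apply: le_trans (lerD (chain_norm_ub f n hx) (chain_norm_ub g n hx)).
by rewrite -big_split /=; apply: ler_sum => k _; exact: ler_normD.
Qed.

Lemma chain_normZ_le a f : chain_norm (a *: f) <= `|a| * chain_norm f.
Proof.
apply: chain_norm_le => x n hx.
apply: le_trans (ler_wpM2l (normr_ge0 a) (chain_norm_ub f n hx)).
by rewrite mulr_sumr; apply: ler_sum => k _; rewrite -normrM.
Qed.

Fact chain_normZ a f : chain_norm (a *: f) = `|a| * chain_norm f.
Proof.
apply/eqP; rewrite eq_le chain_normZ_le /=.
have [->|a0] := eqVneq a 0.
  by rewrite normr0 mul0r (le_trans _ (chain_norm_ge _ (0%N, 0%N))).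
have := chain_normZ_le a^-1 (a *: f).
by rewrite scalerA mulVf// scale1r normfV ler_pdivlMl ?normr_gt0.
Qed.

Fact chain_norm0_eq0 f : chain_norm f = 0 -> f = 0.
Proof.
move=> f0; apply: chain_eq => p; apply/eqP; rewrite -normr_le0 -f0.
exact: chain_norm_ge.
Qed.

HB.instance Definition _ := @Lmodule_isNormed.Build R chain_space
  chain_norm chain_normD chain_normZ chain_norm0_eq0.

Fact chain_complete (F : set_system chain_space) :
  ProperFilter F -> cauchy F -> cvg F.
Proof.
apply: complete_of_fast_cauchy => y hy.
have /choice[l yl] : forall p, exists l : R, (fun n => y n p) @ \oo --> l.
  move=> p; apply/cvg_ex; apply: (@fast_cauchy_cvg R R^o) => n.
  exact: le_trans (chain_norm_ge (y n.+1 - y n) p) (hy n).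
(* Each finite chain sum passes to the pointwise limit, and the bound does not depend on the chain;
   so pointwise convergence is convergence in norm. *)
have ly n x N : interval_chain x ->
    \sum_(k < N) `|l (x k) - y n (x k)| <= 2 * 2^-1 ^+ n.
  move=> hx; have cv : (fun m => \sum_(k < N) `|y (n + m)%N (x k) - y n (x k)|)
      @ \oo --> \sum_(k < N) `|l (x k) - y n (x k)|.
    apply: cvg_big => [|k _]; first exact: add_continuous.
    apply: cvg_norm; apply: cvgB; last exact: cvg_cst.
    by under eq_fun do rewrite addnC; have := yl (x k); rewrite -(cvg_shiftn n).
  apply: (closed_cvg (fun z : R => z <= 2 * 2^-1 ^+ n) _ _ _ cv).
    exact: closed_le.
  apply: nearW => m /=; apply: le_trans (fast_cauchy_bound n m hy).
  exact: (chain_norm_ub (y (n + m)%N - y n)).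
have lP : l \in chain_pred.
  apply/chain_predP; exists (2 * 2^-1 ^+ 0 + chain_norm (y 0%N)) => x n hx.
  apply: le_trans (lerD (ly 0%N x n hx) (chain_norm_ub (y 0%N) n hx)).
  rewrite -big_split /=; apply: ler_sum => k _.
  by rewrite -[l (x k) in leLHS](subrK (y 0%N (x k))); exact: ler_normD.
have e0 : (fun n => 2 * 2^-1 ^+ n : R) @ \oo --> (0 : R).
  by apply: cvg_geometric; rewrite ger0_norm// invf_lt1 ?ltr1n.
apply: (@cvgP _ _ (ChainSpace lP)); apply/cvgrPdist_le => e e_gt0.
have := e0 => /cvgrPdist_lt/(_ _ e_gt0); apply: filterS => n.
rewrite sub0r normrN ger0_norm ?mulr_ge0 ?exprn_ge0// => ne.
by apply: chain_norm_le => x N hx; exact: le_trans (ly n x N hx) (ltW ne).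
Qed.

HB.instance Definition _ := Uniform_isComplete.Build chain_space chain_complete.

Definition chain_le f g : Prop := forall p, f p <= g p.

Lemma chain_join_proof f g : (fun p => Num.max (f p) (g p)) \in chain_pred.
Proof.
have /chain_predP[M hM] := chain_valP f.
have /chain_predP[N hN] := chain_valP g.
apply/chain_predP; exists (M + N) => x n hx.
apply: le_trans (lerD (hM x n hx) (hN x n hx)).
rewrite -big_split /=; apply: ler_sum => k _.
by rewrite maxEle; case: ifP => _; rewrite ?lerDr ?lerDl.
Qed.
Definition chain_join f g : chain_space := ChainSpace (chain_join_proof f g).

Lemma chain_meet_proof f g : (fun p => Num.min (f p) (g p)) \in chain_pred.
Proof.
have := chain_valP (- chain_join (- f) (- g)); rewrite /in_mem /=.
congr (is_true (chain_pred _)); apply/funext => p.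
by rewrite -[LHS]/(- Num.max (- f p) (- g p)) -oppr_min opprK.
Qed.
Definition chain_meet f g : chain_space := ChainSpace (chain_meet_proof f g).

Fact chain_le_refl f : chain_le f f. Proof. by move=> p. Qed.

Fact chain_le_anti f g : chain_le f g -> chain_le g f -> f = g.
Proof.
by move=> fg gf; apply: chain_eq => p; apply: le_anti; rewrite fg gf.
Qed.

Fact chain_le_trans f g h : chain_le f g -> chain_le g h -> chain_le f h.
Proof. by move=> fg gh p; exact: le_trans (fg p) (gh p). Qed.

Fact chain_join_le f g h :
  chain_le (chain_join f g) h <-> chain_le f h /\ chain_le g h.
Proof.
split=> [H|[fh gh] p]; last by rewrite ge_max fh gh.
by split=> p; have := H p; rewrite ge_max => /andP[].
Qed.

Fact chain_le_meet f g h :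
  chain_le h (chain_meet f g) <-> chain_le h f /\ chain_le h g.
Proof.
split=> [H|[hf hg] p]; last by rewrite le_min hf hg.
by split=> p; have := H p; rewrite le_min => /andP[].
Qed.

Fact chain_le_add2r h f g : chain_le f g -> chain_le (f + h) (g + h).
Proof. by move=> fg p; exact: lerD (fg p) (lexx _). Qed.

Fact chain_scale_ge0 (a : R) f : 0 <= a -> chain_le 0 f -> chain_le 0 (a *: f).
Proof. by move=> a0 f0 p; exact: mulr_ge0 a0 (f0 p). Qed.

Lemma chain_absE f p : chain_join f (- f) p = `|f p|.
Proof.
rewrite -[LHS]/(Num.max (f p) (- f p)) maxC real_maxNr//.
exact: num_real.
Qed.

Fact chain_le_norm f g :
  chain_le (chain_join f (- f)) (chain_join g (- g)) -> `|f| <= `|g|.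
Proof.
move=> H; apply: chain_norm_le => x n hx.
apply: le_trans (chain_norm_ub g n hx).
by apply: ler_sum => k _; rewrite -!chain_absE; exact: H.
Qed.

HB.instance Definition _ :=
  CompleteNormedModule_isBanachLattice.Build R chain_space
  chain_le_refl chain_le_anti chain_le_trans chain_join_le chain_le_meet
  chain_le_add2r chain_scale_ge0 chain_le_norm.

Definition null_rows : set chain_space :=
  [set f | forall i, f (i, m) @[m --> \oo] --> (0 : R)].

Lemma null_rows0 : null_rows 0.
Proof. by move=> i; exact: cvg_cst. Qed.

Lemma null_rowsD f g : null_rows f -> null_rows g -> null_rows (f + g).
Proof.
by move=> f0 g0 i; rewrite -[X in _ --> X](addr0 (0 : R)); exact: cvgD.
Qed.

Lemma null_rowsZ (a : R) f : null_rows f -> null_rows (a *: f).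
Proof.
by move=> f0 i; rewrite -[X in _ --> X](mulr0 a); exact: cvgMr.
Qed.

Lemma null_rows_solid f g : vle (vabs f) (vabs g) -> null_rows g -> null_rows f.
Proof.
move=> fg g0 i; apply/cvgrPdist_lt => e e_gt0.
have /cvgrPdist_lt/(_ _ e_gt0) := g0 i; apply: filterS => m.
rewrite !sub0r !normrN; apply: le_lt_trans.
by have := fg (i, m); rewrite !chain_absE.
Qed.

Lemma null_rows_closed : closed null_rows.
Proof.
move=> f Jf i; apply/cvgrPdist_lt => e e_gt0.
have e20 : 0 < e / 2 by rewrite divr_gt0.
have [g [g0]] := Jf _ (nbhsx_ballx f _ e20).
rewrite -ball_normE /ball_/= => fg.
have /cvgrPdist_lt/(_ _ e20) := g0 i; apply: filterS => m.
rewrite !sub0r !normrN => gm.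
rewrite -(subrK (g (i, m)) (f (i, m))) (le_lt_trans (ler_normD _ _))//.
by rewrite [e]splitr ltrD// (le_lt_trans (chain_norm_ge (f - g) _) fg).
Qed.

Definition null_rows_ideal : closed_ideal chain_space :=
  ClosedIdeal null_rows0 null_rowsD null_rowsZ null_rows_solid null_rows_closed.

End ChainSpace.

Lemma ler_sum_uniq (R : numDomainType) (F : nat -> R) (s : seq nat) (n : nat) :
  (forall k, 0 <= F k) -> uniq s -> (forall k, k \in s -> (k < n)%N) ->
  \sum_(k <- s) F k <= \sum_(k < n) F k.
Proof.
move=> F0 us sn; have -> : \sum_(k <- s) F k = \sum_(0 <= k < n | k \in s) F k.
  rewrite -[RHS]big_filter; apply: perm_big; apply: uniq_perm => //.
    by rewrite filter_uniq// iota_uniq.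
  move=> k; rewrite mem_filter mem_index_iota /=.
  by case: (boolP (k \in s)) => // /sn ->.
by rewrite -(big_mkord xpredT) big_mkcond; apply: ler_sum => k _; case: ifP.
Qed.

(** * Row limits and the homomorphism from [c_0] to [Y/J] *)

Section RowLimits.
Context (R : realType).
Local Notation Y := (chain_space R).
Local Notation J := (null_rows_ideal R).

Definition row_limit (f : Y) (a : nat -> R) : Prop :=
  forall i, f (i, m) @[m --> \oo] --> a i.

(* [a i] is placed at [(i, m)] only once all later [a n] are at most half of *)
(* it, so along a chain the nonzero values decay geometrically.              *)
Lemma row_limit_lift (a : c0 R) : exists2 f, row_limit f a & `|f| <= 2 * `|a|.
Proof.
have /choice[M hM] : forall i, exists N, a i != 0 ->
    forall n, (N <= n)%N -> `|a n| <= `|a i| / 2.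
  move=> i; have [->|ai] := eqVneq (a i) 0; first by exists 0%N.
  have e0 : 0 < `|a i| / 2 by rewrite divr_gt0// normr_gt0.
  have /cvgrPdist_le/(_ _ e0)[N _ hN] := @c0_cvg R a.
  by exists N => _ n Nn; have := hN n Nn; rewrite /= sub0r normrN.
pose f (p : nat * nat) : R := if (M p.1 <= p.2)%N then a p.1 else 0.
(* [B] must vary in the induction: after a nonzero first term [a i] the tail has bound [|a i| / 2],
   and [|a i| + 2 * (|a i| / 2) <= 2 * B]. *)
have hf n (B : R) x : interval_chain x ->
    (forall j, ((x 0%N).1 <= j)%N -> `|a j| <= B) ->
    \sum_(k < n) `|f (x k)| <= 2 * B.
  elim: n B x => [|n IH] B x hx hB.
    by rewrite big_ord0 mulr_ge0// (le_trans _ (hB _ (leqnn _))).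
  have hx' : interval_chain (x \o succn) by exact: interval_chain_comp.
  have := hx 0%N 1%N isT; rewrite gtn_max => /andP[x11 x12].
  rewrite big_ord_recl; have [|] := eqVneq (f (x 0%N)) 0.
    move=> /= ->; rewrite normr0 add0r; apply: (IH B (x \o succn)) => // j xj.
    by apply: hB; exact: leq_trans (ltnW x11) xj.
  rewrite /= {1 2}/f; case: ifPn => [Mx a0|_]; last by rewrite eqxx.
  have := IH (`|a (x 0%N).1| / 2) (x \o succn) hx'.
  have := hB _ (leqnn _); rewrite /= /bump /= => aB IH'.
  suff: \sum_(k < n) `|f (x k.+1)| <= 2 * (`|a (x 0%N).1| / 2) by lra.
  apply: IH' => j xj; apply: hM => //.
  exact: leq_trans Mx (leq_trans (ltnW x12) xj).
have fP : f \in @chain_pred R.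
  apply/chain_predP; exists (2 * `|a|) => x n hx.
  by apply: hf => // j _; exact: c0_norm_ub.
exists (ChainSpace fP); last first.
  apply: chain_norm_le => x n hx.
  by apply: hf => // j _; exact: c0_norm_ub.
move=> i; apply: cvg_near_cst; exists (M i) => // m /= Mm.
by rewrite /f /= Mm.
Qed.

(** [J] consists of the functions with zero row limits, so row limits are a property of the class in
    [Y/J] and determine it. *)
Lemma row_limitP f g a : row_limit f a ->
  vquotient_map J f = vquotient_map J g <-> row_limit g a.
Proof.
move=> fa; split=> [/vquotient_map_eq fg i|ga].
  rewrite -[a i]subr0 (_ : (fun _ => _) = fun m => f (i, m) - (f - g) (i, m)).
    exact: cvgB.
  by apply/funext => m; exact/esym/subKr.
suff fg : null_rows (f - g) by apply/vquotient_map_eq.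
move=> i; have h := cvgB (fa i) (ga i); rewrite subrr in h; exact: h.
Qed.

Lemma row_limit_join f g (a b : c0 R) :
  row_limit f a -> row_limit g b -> row_limit (vjoin f g) (vjoin a b).
Proof.
move=> fa gb i.
rewrite -[X in _ --> X]/(Num.max (a i) (b i)) maxr_absE.
rewrite (_ : (fun _ => _) =
    fun m => (f (i, m) + g (i, m) + `|f (i, m) - g (i, m)|) / 2); last first.
  by apply/funext => m; rewrite -maxr_absE.
apply: cvgMl; apply: cvgD; first exact: cvgD.
by apply: cvg_norm; exact: cvgB.
Qed.

Lemma row_limit_meet f g (a b : c0 R) :
  row_limit f a -> row_limit g b -> row_limit (vmeet f g) (vmeet a b).
Proof.
move=> fa gb i.
rewrite -[X in _ --> X]/(Num.min (a i) (b i)) minr_absE.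
rewrite (_ : (fun _ => _) =
    fun m => (f (i, m) + g (i, m) - `|f (i, m) - g (i, m)|) / 2); last first.
  by apply/funext => m; rewrite -minr_absE.
apply: cvgMl; apply: cvgB; first exact: cvgD.
by apply: cvg_norm; exact: cvgB.
Qed.

(** The chosen lifts [L a] need not depend linearly on [a], but their classes depend only on the row
    limits, and these respect sums, multiples, joins and meets. *)
Lemma c0_quotient_hom : exists2 S : {linear c0 R -> vquotient J},
  lattice_hom S & forall a f, S a = vquotient_map J f -> row_limit f a.
Proof.
have /choice[L hL] : forall a : c0 R, exists f,
    row_limit f a /\ `|f| <= 2 * `|a|.
  by move=> a; have [f] := row_limit_lift a; exists f.
pose S0 a : vquotient J := vquotient_map J (L a).
have S0E (a : c0 R) f : row_limit f a -> S0 a = vquotient_map J f.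
  by move=> fa; apply/(row_limitP f (hL a).1).
have S0_lin : linear S0.
  move=> c a b; rewrite {2 3}/S0 -linearP; apply: S0E => i.
  by apply: cvgD; [apply: cvgMr|]; exact: (hL _).1.
pose S : {linear c0 R -> vquotient J} :=
  HB.pack S0 (GRing.isLinear.Build R _ _ _ S0 S0_lin).
have Qhom := vquotient_map_hom J.
exists S; last by move=> a f /(row_limitP f (hL a).1).
split=> [r|a b|a b].
- exists (2 * r) => a ar; apply: le_trans (vquotient_norm_le _ _) _.
  by apply: le_trans (hL a).2 _; rewrite ler_wpM2l.
- rewrite -[LHS]/(S0 _) -[RHS]/(vjoin (S0 a) (S0 b)) -(hom_join Qhom).
  by apply: S0E; apply: row_limit_join; exact: (hL _).1.
- rewrite -[LHS]/(S0 _) -[RHS]/(vmeet (S0 a) (S0 b)) -(hom_meet Qhom).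
  by apply: S0E; apply: row_limit_meet; exact: (hL _).1.
Qed.

(** * The lower l_1-estimate in [Y] *)

Lemma chain_sumE (n : nat) (f : nat -> Y) p :
  (\sum_(k < n) f k) p = \sum_(k < n) f k p.
Proof. by elim/big_rec2: _ => // k s t _ <-. Qed.

(** The norm is tested on a single chain: diagonal values are at least 1/2, and disjointification
    brings the off-diagonal row sums down to 1/4, which leaves 1/4. *)
Lemma chain_space_l1 (f : nat -> Y) (C : R) :
  (forall i, `|f i| <= C) -> (forall i, row_limit (f i) (c0_basis R i)) ->
  exists2 phi : nat -> nat, {homo phi : m n / (m < n)%N} &
    forall l (a : nat -> R), 4^-1 * (\sum_(k < l) `|a k|) <=
      `|\sum_(k < l) a k *: f (phi k)|.
Proof.
move=> fC fe.
have /choice[M hM] : forall i, exists m, 2^-1 <= `|f i (i, m)|.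
  move=> i; have e0 : 0 < 2^-1 :> R by rewrite invr_gt0.
  have /cvgrPdist_le/(_ _ e0)/filter_ex[m] := fe i i.
  rewrite /= eqxx => hm; exists m.
  have := lerB_dist (1 : R) (1 - f i (i, m)); rewrite normr1 subKr.
  by move/(le_trans _); apply; lra.
pose idx k := iter k (fun i => (maxn i (M i)).+1) 0%N.
pose x k := (idx k, M (idx k)).
have hx : interval_chain x by apply: interval_chain_step => k /=.
have hidx : {homo idx : m n / (m < n)%N}.
  by apply: homo_ltn; [exact: ltn_trans|move=> k /=; rewrite ltnS leq_maxl].
(* Each row is a chain sum of one [f (idx j)], whence the bound [C]. *)
have hA : off_diagonal_le C (fun j k => `|f (idx j) (x k)|).
  move=> j s us _.
  apply: le_trans (fC (idx j)).
  apply: le_trans (chain_norm_ub _ (\max_(k <- s) k).+1 hx).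
  apply: (ler_sum_uniq (F := fun k => `|f (idx j) (x k)|)) => // k ks.
  by rewrite ltnS; exact: leq_bigmax_seq.
have e0 : 0 < 4^-1 :> R by rewrite invr_gt0.
have [phi hphi off] := rosenthal_increasing e0 hA.
exists (idx \o phi) => [m n /hphi/hidx//|l a].
set g := (X in _ <= `|X|).
apply: le_trans (chain_norm_ub g l (interval_chain_comp hphi hx)).
pose G (j k : 'I_l) := `|f (idx (phi j)) (x (phi k))|.
have hg (k : 'I_l) : `|a k| / 2 - \sum_(j < l | j != k) `|a j| * G j k <=
    `|g (x (phi k))|.
  rewrite [g _](chain_sumE l (fun j => a j *: f (idx (phi j)))).
  rewrite [in leRHS](bigD1 k)//=.
  apply: le_trans (lerB_normD _ _); apply: lerB.
    rewrite -[(_ *: _) _]/(a k * f (idx (phi k)) (x (phi k))) normrM.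
    by rewrite ler_wpM2l//; exact: hM.
  apply: le_trans (ler_norm_sum _ _ _) _; apply: ler_sum => j _.
  by rewrite -normrM.
apply: le_trans (ler_sum _ (fun k _ => hg k)); rewrite sumrB -mulr_suml.
(* Summing over the points [k] first turns the error into row sums weighted by [|a j|], which [off]
   controls. *)
rewrite (exchange_big_dep xpredT)//=.
have : \sum_(j < l) \sum_(k < l | j != k) `|a j| * G j k <=
    \sum_(j < l) `|a j| / 4.
  apply: ler_sum => j _; rewrite -mulr_sumr ler_wpM2l//.
  have := off j [seq k <- index_iota 0 l | nat_of_ord j != k].
  rewrite mem_filter eqxx filter_uniq ?iota_uniq// big_filter.
  by rewrite big_mkord; exact.
rewrite -mulr_suml; lra.
Qed.

End RowLimits.

(** * Lifting to [Y] and transfer of the estimate to [X] *)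

Theorem theorem1p2 (R : realType) (X : banachLatticeType R) (u : nat -> X) :
  infty_projective X ->
  bounded_fun u ->
  (exists2 T : {linear X -> c0 R}, lattice_hom T &
     forall i : nat, T (u i) = c0_basis R i) ->
  exists2 phi : nat -> nat, {homo phi : m n / (m < n)%N} &
    equivalent_l1_basis (u \o phi).
Proof.
move=> [lambda _ projX] /pinfty_ex_gt0[C C0 uC] [T Thom Tu].
have [S Shom Slim] := c0_quotient_hom R.
have STlin : linear (S \o T) by move=> c v w; rewrite /= !linearP.
pose ST : {linear X -> vquotient (null_rows_ideal R)} :=
  HB.pack (S \o T) (GRing.isLinear.Build R _ _ _ (S \o T) STlin).
have SThom : lattice_hom ST.
  split=> [r|v w|v w].
  - have [M TM] := hom_bounded Thom r; have [N SN] := hom_bounded Shom M.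
    by exists N => v vr; apply: SN; exact: TM.
  - by rewrite /= (hom_join Thom) (hom_join Shom).
  - by rewrite /= (hom_meet Thom) (hom_meet Shom).
have [That [[/bounded_funP/linear_boundedP/pinfty_ex_gt0[K K0 TK] _ _] TQ _]] :=
  projX _ _ _ SThom.
have uC' i : `|u i| <= C by exact: uC.
have [i||phi hphi hl1] := @chain_space_l1 R (That \o u) (K * C).
- by apply: le_trans (TK _) _; rewrite ler_wpM2l// ltW.
- by move=> i; apply: Slim; rewrite -Tu; exact: TQ.
(* [K] bounds the lift [That], so the factor 1/4 valid in [Y] becomes [4^-1 / K] in [X]; [C] bounds
   the [u i]. *)
exists phi => //; exists (4^-1 / K), C; split=> // [|l a].
  by rewrite divr_gt0// invr_gt0.
apply/andP; split.
  rewrite mulrAC ler_pdivrMr// [leRHS]mulrC; apply: le_trans (hl1 l a) _.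
  apply: le_trans (TK _); rewrite linear_sum.
  by under [X in _ <= `|X|]eq_bigr do rewrite linearZ.
apply: le_trans (ler_norm_sum _ _ _) _; rewrite mulr_sumr.
apply: ler_sum => k _.
by rewrite normrZ mulrC; apply: ler_wpM2r => //; exact: uC'.
Qed.
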